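(* Let $K$ be a field and let $L=I_1+J_1\subset K[x_1,\dots,x_n,y_1,\dots,y_m]$, where $I_1$ is generated by all squarefree monomials of degree $1$ in $K[x_1,\dots,x_n]$ and $J_1$ is generated by all squarefree monomials of degree $1$ in $K[y_1,\dots,y_m]$. Then $L$ is matroidal.
   Context: For a monomial ideal $I$ in a polynomial ring, $G(I)$ is its unique minimal set of monomial generators. A monomial ideal $I$ generated in a single degree is polymatroidal if for any $u,v\in G(I)$ and any variable $z$ with $\deg_z(u)>\deg_z(v)$ there is a variable $w$ with $\deg_w(u)<\deg_w(v)$ such that $w(u/z)\in I$. It is matroidal if it is polymatroidal and generated by squarefree monomials. *)

(* Defs.v *)
From HB Require Import structures.
From mathcomp Require Export all_boot all_order all_algebra.
From mathcomp Require Export boolp classical_sets.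
From mathcomp Require Export mpoly.

Set Implicit Arguments.
Unset Strict Implicit.
Unset Printing Implicit Defensive.

Import GRing.Theory.

Local Open Scope classical_set_scope.
Local Open Scope ring_scope.

(* MathComp's idealr structure only covers proper ideals with decidable
   membership, hence ideals are represented here as plain sets. *)
Definition ideal_gen (R : comNzRingType) (A : set R) : set R :=
  [set p | exists s : seq (R * R),
     (forall x, x \in s -> A x.2) /\ p = \sum_(x <- s) x.1 * x.2].

Definition ideal_sum (R : comNzRingType) (I J : set R) : set R :=
  [set p + q | p in I & q in J].

Definition ideal_ext (R S : comNzRingType) (f : R -> S) (I : set R) : set S :=
  ideal_gen (f @` I).

(* A monomial of K[z_0, ..., z_(N-1)] is given by its exponent vector
   u : 'X_{1..N}: u i is its degree in z_i, 'X_[u] the monomial itself, and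
   (u <= v)%MM is divisibility. *)
Definition mon_ideal (K : fieldType) (N : nat) (A : set 'X_{1..N}) :
    set {mpoly K[N]} :=
  ideal_gen [set 'X_[u] | u in A].
Arguments mon_ideal K {N} A _.

(* G = G(I). An I for which such a G exists is a monomial ideal; G is unique
   by min_mongens_uniq. *)
Definition min_mongens (K : fieldType) (N : nat) (I : set {mpoly K[N]})
    (G : set 'X_{1..N}) : Prop :=
  mon_ideal K G = I /\
  forall H : set 'X_{1..N}, H `<=` G -> mon_ideal K H = I -> H = G.

(* The truncated subtraction is exact: u z > v z forces u z > 0. *)
Definition polymatroidal (K : fieldType) (N : nat) (I : set {mpoly K[N]}) :
    Prop :=
  exists (d : nat) (G : set 'X_{1..N}),
    [/\ min_mongens I G,
        forall u, G u -> mdeg u = d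
      & forall u v, G u -> G v -> forall z : 'I_N, (v z < u z)%N ->
          exists2 w : 'I_N, (u w < v w)%N &
            I 'X_[(u - U_(z) + U_(w))%MM]].

Definition sqfree (N : nat) (u : 'X_{1..N}) : Prop :=
  forall i, (u i <= 1)%N.

Definition matroidal (K : fieldType) (N : nat) (I : set {mpoly K[N]}) : Prop :=
  polymatroidal I /\
  exists2 A : set 'X_{1..N}, (forall u, A u -> sqfree u) & I = mon_ideal K A.

Definition sqfree_ideal (K : fieldType) (N d : nat) : set {mpoly K[N]} :=
  mon_ideal K [set u : 'X_{1..N} | sqfree u /\ mdeg u = d].
Arguments sqfree_ideal K N d _ : clear implicits.

(* In K[x_1, ..., x_n, y_1, ..., y_m] = {mpoly K[n + m]} the x's are the first
   n variables and the y's the last m. *)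
Definition xincl (K : fieldType) (n m : nat) (p : {mpoly K[n]}) :
    {mpoly K[n + m]} :=
  p \mPo [tuple 'X_(lshift m i) | i < n].
Arguments xincl {K n} m p.

Definition yincl (K : fieldType) (n m : nat) (p : {mpoly K[m]}) :
    {mpoly K[n + m]} :=
  p \mPo [tuple 'X_(rshift n i) | i < m].
Arguments yincl {K} n {m} p.

Lemma mon_ideal_mem (K : fieldType) (N : nat) (A : set 'X_{1..N})
    (p : {mpoly K[N]}) (u : 'X_{1..N}) :
  mon_ideal K A p -> u \in msupp p -> exists2 a, A a & (a <= u)%MM.
Proof.
move=> [s [As ->]]; elim: s As => [|[c q] s IH] As.
  by rewrite big_nil msupp0 in_nil.
rewrite big_cons => /msuppD_le; rewrite mem_cat => /orP[|]; last first.
  by apply: IH => y ys; apply: As; rewrite in_cons ys orbT.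
have [/= a Aa <-] := As _ (mem_head _ _).
rewrite (perm_mem (msuppMX _ _)) => /mapP[b _ ->].
by exists a => //; apply: lem_addr.
Qed.

Lemma mon_ideal_sub (K : fieldType) (N : nat) (A B : set 'X_{1..N}) :
  (forall a, A a -> exists2 b, B b & (b <= a)%MM) ->
  mon_ideal K A `<=` mon_ideal K B.
Proof.
move=> AB p [s [As ->]]; elim: s As => [|[c q] s IH] As.
  by exists [::]; rewrite !big_nil.
have [|t [Bt Et]] := IH.
  by move=> y ys; apply: As; rewrite in_cons ys orbT.
have [/= a /AB[b Bb ba] <-] := As _ (mem_head _ _).
exists ((c * 'X_[(a - b)%MM], 'X_[b]) :: t); split.
  by move=> y; rewrite in_cons => /orP[/eqP->|/Bt//]; exists b.
by rewrite !big_cons Et /= -mulrA -mpolyXD submK.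
Qed.

Lemma min_mongens_uniq (K : fieldType) (N : nat) (I : set {mpoly K[N]})
    (G H : set 'X_{1..N}) :
  min_mongens I G -> min_mongens I H -> G = H.
Proof.
have mem (A B : set 'X_{1..N}) a : mon_ideal K A = mon_ideal K B -> A a ->
    exists2 b, B b & (b <= a)%MM.
  move=> AB Aa; apply: (@mon_ideal_mem K N B 'X_[a]); last first.
    by rewrite msuppX mem_head.
  rewrite -AB; exists [:: (1, 'X_[a])]; split; last by rewrite big_seq1 mul1r.
  by move=> x; rewrite inE => /eqP->; exists a.
suff sub (A B : set 'X_{1..N}) :
    min_mongens I A -> min_mongens I B -> A `<=` B.
  by move=> mG mH; apply/seteqP; split; apply: sub.
move=> [IA minA] [IB _] a Aa.
have [b Bb ba] := mem A B a (etrans IA (esym IB)) Aa.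
have [a' Aa' a'b] := mem B A b (etrans IB (esym IA)) Bb.
have a'a := lepm_trans a'b ba.
have [eaa'|naa'] := eqVneq a' a.
  suff -> : a = b by [].
  apply/mnmP => i; apply/eqP; rewrite eqn_leq (mnm_lepP ba) andbT.
  by rewrite -{1}eaa' (mnm_lepP a'b).
have sD : A `\ a `<=` A by move=> x [].
suff IAD : mon_ideal K (A `\ a) = I.
  by move: Aa; rewrite -(minA _ sD IAD) => -[_ []].
rewrite -IA; apply/seteqP; split; apply: mon_ideal_sub => x.
  by move=> [Ax _]; exists x => //; apply: lepm_refl.
move=> Ax; have [->|/eqP nxa] := eqVneq x a.
  by exists a' => //; split=> //; apply/eqP.
by exists x; [split | apply: lepm_refl].
Qed.

(* Main.v *)
Require Import Defs.

Set Implicit Arguments.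
Unset Strict Implicit.
Unset Printing Implicit Defensive.

Import GRing.Theory.

Local Open Scope classical_set_scope.
Local Open Scope ring_scope.

(** A squarefree monomial of degree 1 is a variable, so [I_1] is generated by
    the [x_i] and [J_1] by the [y_j]. Extending an ideal along a ring morphism
    maps its generators ([ideal_ext_gen]) and adding two ideals unites their
    generators ([ideal_sum_gen]); hence [L] is the ideal of all [n + m]
    variables, that is, the squarefree ideal of degree 1 of the big ring.

    That ideal is matroidal. Its variables all have the same degree, so none of
    them divides another and they are the minimal generators
    ([min_mongens_equidegree]). Exchange is immediate: if [deg_z] is larger in
    the variable [u] than in the variable [v], then [u = z], and replacing [z]
    by [w = v] turns [u] into [v] itself. *)

Section IdealGen.
Variable R : comNzRingType.
Implicit Types A B : set R.

Lemma ideal_gen0 A : ideal_gen A 0.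
Proof. by exists [::]; rewrite big_nil. Qed.

Lemma ideal_genD A p q : ideal_gen A p -> ideal_gen A q -> ideal_gen A (p + q).
Proof.
move=> [s [As ->]] [t [At ->]]; exists (s ++ t); rewrite big_cat; split=> // x.
by rewrite mem_cat => /orP[/As|/At].
Qed.

Lemma ideal_genMl A c p : ideal_gen A p -> ideal_gen A (c * p).
Proof.
move=> [s [As ->]]; exists [seq (c * x.1, x.2) | x <- s]; split.
  by move=> _ /mapP[x /As Ax ->].
by rewrite big_map mulr_sumr; apply: eq_bigr => x _; rewrite mulrA.
Qed.

Lemma sub_ideal_gen A : A `<=` ideal_gen A.
Proof.
move=> p Ap; exists [:: (1, p)]; rewrite big_seq1 mul1r; split=> // x.
by rewrite inE => /eqP->.
Qed.

Lemma ideal_gen_sub A B : A `<=` ideal_gen B -> ideal_gen A `<=` ideal_gen B.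
Proof.
move=> AB p [s [As ->]]; rewrite big_seq.
apply: (big_ind (ideal_gen B)) => [||x /As/AB Bx].
- exact: ideal_gen0.
- exact: ideal_genD.
- exact: ideal_genMl.
Qed.

(** Sort the terms of a combination by the set their generator comes from; a
    generator in both may go to either side. *)
Lemma ideal_sum_gen A B :
  ideal_sum (ideal_gen A) (ideal_gen B) = ideal_gen (A `|` B).
Proof.
apply/seteqP; split.
  move=> _ [p Ap [q Bq <-]]; apply: ideal_genD.
    by apply: (ideal_gen_sub _ Ap) => x Ax; apply: sub_ideal_gen; left.
  by apply: (ideal_gen_sub _ Bq) => x Bx; apply: sub_ideal_gen; right.
move=> _ [s [ABs ->]]; elim: s ABs => [|[c a] s IH] ABs.
  rewrite big_nil; exists 0; first exact: ideal_gen0.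
  by exists 0; [exact: ideal_gen0 | rewrite addr0].
have [|p Ap [q Bq Epq]] := IH.
  by move=> x xs; apply: ABs; rewrite in_cons xs orbT.
rewrite big_cons -Epq /=; have [/= Aa|/= Ba] := ABs _ (mem_head _ _).
  exists (c * a + p); last by exists q => //; rewrite addrA.
  by apply: ideal_genD Ap; apply/ideal_genMl/sub_ideal_gen.
exists p => //; exists (c * a + q); last by rewrite addrCA.
by apply: ideal_genD Bq; apply/ideal_genMl/sub_ideal_gen.
Qed.

End IdealGen.

(** The image of a combination of [A] is a combination of [f @` A] with the
    image coefficients, so only the generators matter even though [f] need not
    be surjective and [f @` ideal_gen A] need not be an ideal. *)
Lemma ideal_ext_gen (R S : comNzRingType) (f : {rmorphism R -> S}) (A : set R) :
  ideal_ext f (ideal_gen A) = ideal_gen (f @` A).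
Proof.
apply/seteqP; split; apply: ideal_gen_sub; last first.
  move=> _ [a Aa <-]; apply: sub_ideal_gen.
  by exists a => //; apply: sub_ideal_gen.
move=> _ [p [s [As ->]] <-]; rewrite rmorph_sum big_seq.
apply: (big_ind (ideal_gen _)) => [||x /As Ax].
- exact: ideal_gen0.
- exact: ideal_genD.
- by rewrite rmorphM; apply/ideal_genMl/sub_ideal_gen; exists x.2.
Qed.

Section Variables.
Variables (K : fieldType) (N : nat).

(** The cofactor [v - u] has degree 0, so it is the trivial monomial. *)
Lemma lepm_mdeg_eq (u v : 'X_{1..N}) :
  (u <= v)%MM -> mdeg u = mdeg v -> u = v.
Proof.
move=> uv; rewrite -(submK uv) mdegD -{1}[mdeg u]add0n => /addIn/esym/eqP.
by rewrite mdeg_eq0 => /eqP->; rewrite add0m.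
Qed.

(** A smaller generating set still needs a divisor of each [a] in [G], and in
    [G] the only divisor of [a] is [a]. *)
Lemma min_mongens_equidegree (G : set 'X_{1..N}) d :
  (forall u, G u -> mdeg u = d) -> min_mongens (mon_ideal K G) G.
Proof.
move=> Gd; split=> // H HG eHG; apply/seteqP; split=> // a Ga.
have [||b Hb ba] := @mon_ideal_mem K N H 'X_[a] a.
- by rewrite eHG; apply: sub_ideal_gen; exists a.
- by rewrite msuppX mem_head.
by rewrite -(lepm_mdeg_eq ba) // (Gd _ Ga) (Gd _ (HG _ Hb)).
Qed.

Lemma sqfree_mdeg1 :
  [set u : 'X_{1..N} | sqfree u /\ mdeg u = 1%N] =
  range (fun i : 'I_N => U_(i)%MM).
Proof.
apply/seteqP; split=> u.
  by move=> [_ /eqP/mdeg1P[i /eqP->]]; exists i.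
by move=> [i _ <-]; split=> [j|]; rewrite ?mdeg1 // mnm1E; case: eqP.
Qed.

Lemma sqfree_ideal1 :
  sqfree_ideal K N 1 = ideal_gen (range (fun i : 'I_N => 'X_i)).
Proof.
by rewrite /sqfree_ideal sqfree_mdeg1 /mon_ideal image_comp.
Qed.

Lemma matroidal_sqfree_ideal1 : matroidal (sqfree_ideal K N 1).
Proof.
split; last by eexists; last reflexivity; move=> u [].
exists 1%N; eexists; split.
- by apply: (@min_mongens_equidegree _ 1) => u [].
- by move=> u [].
move=> u v; rewrite sqfree_mdeg1 => -[i _ <-] [j _ <-] z.
rewrite !mnm1E => ltz.
(* The hypothesis on [z] forces [z = i] and [z <> j], so the only variable
   whose degree can go up is [j]. *)
exists j; move: ltz.
  rewrite !mnm1E eqxx; case: (i =P z) => // <-; rewrite eq_sym.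
  by case: (i == j).
case: (i =P z) => [->|]; last by case: (j == z).
(* The exchanged monomial [U_(z) - U_(z) + U_(j)] is the generator [U_(j)]. *)
rewrite sqfree_ideal1 -{1}[U_(z)%MM]add0m addmK add0m => _.
by apply: sub_ideal_gen; exists j.
Qed.

End Variables.

Theorem theorem2p4 (K : fieldType) (n m : nat) :
  matroidal
    (ideal_sum (ideal_ext (xincl m) (sqfree_ideal K n 1))
               (ideal_ext (yincl n) (sqfree_ideal K m 1))).
Proof.
rewrite !sqfree_ideal1.
(* The ring morphism structure of [xincl] and [yincl] is inferred from the
   substitution [comp_mpoly] that they unfold to. *)
rewrite (ideal_ext_gen (comp_mpoly _)) (ideal_ext_gen (comp_mpoly _)).
rewrite ideal_sum_gen !image_comp.
have -> : range (comp_mpoly [tuple 'X_(lshift m i) | i < n] \o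
                 (fun i : 'I_n => 'X_i : {mpoly K[n]})) `|`
          range (comp_mpoly [tuple 'X_(rshift n i) | i < m] \o
                 (fun i : 'I_m => 'X_i : {mpoly K[m]})) =
          range (fun k : 'I_(n + m) => 'X_k : {mpoly K[n + m]}).
  apply/seteqP; split.
    move=> _ [|] [i _ <-] /=; rewrite comp_mpolyXU -tnth_nth tnth_mktuple.
      by exists (lshift m i).
    by exists (rshift n i).
  move=> _ [k _ <-]; case: (split_ordP k) => i ->; [left|right];
    exists i => //=; by rewrite comp_mpolyXU -tnth_nth tnth_mktuple.
rewrite -sqfree_ideal1; exact: matroidal_sqfree_ideal1.
Qed.
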